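(* Let $\tau$ be a structure. If $\tau$ is separable, embedding-continuous, lower semicontinuous, and space-rooted metrizable, then the local GH-type topology with preserved roots on $\mathfrak{M}_\bullet(\tau)$ is separable.
   Context: A bcm (boundedly-compact metric) space is a non-empty metric space in which every closed ball of finite radius is compact; a rooted bcm space $(X,\rho_X)$ is a bcm space $X$ with a distinguished point $\rho_X$. The metric of $X$ is denoted $d_X$, and $D_X(x,r)=\{y: d_X(x,y)\le r\}$. An isometric embedding is a distance-preserving map (not necessarily onto); an isometry is a bijective one; a map is root-preserving if it sends root to root. A topological embedding is a homeomorphism onto its image. Structure: a functor $\tau$ from the category of bcm spaces (morphisms: isometric embeddings) to the category of metrizable topological spaces (morphisms: topological embeddings). That is, to each bcm space $X$ it assigns a metrizable space $\tau(X)$ and to each isometric embedding $f\colon X\to Y$ a topological embedding $\tau_f\colon\tau(X)\to\tau(Y)$, with $\tau_{\mathrm{id}_X}=\mathrm{id}_{\tau(X)}$ and $\tau_{g\circ f}=\tau_g\circ\tau_f$. When $X$ is isometrically embedded into $Y$ by $f$, $\tau(X)$ is regarded as a subspace of $\tau(Y)$ via $\tau_f$. The structure is separable if each $\tau(X)$ is separable. $\tau$ is embedding-continuous if, whenever $X,Y$ are bcm spaces and $f_n\colon X\to Y$, $n\in\mathbb{N}\cup\{\infty\}$, are isometric embeddings with $f_n\to f_\infty$ uniformly on compact sets, one has $\tau_{f_n}(a)\to\tau_{f_\infty}(a)$ in $\tau(Y)$ for all $a\in\tau(X)$. $\tau$ is lower semicontinuous if, whenever bcm spaces $X_n$, $n\in\mathbb{N}\cup\{\infty\}$,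 are isometrically embedded into a common bcm space $Y$ so that $X_n\to X_\infty$ in the Fell topology as subsets of $Y$, then for every $a\in\tau(X_\infty)$ there are a subsequence $(n_k)_{k\ge1}$ and $a_k\in\tau(X_{n_k})$ with $a_k\to a$ in $\tau(Y)$. Here the Fell topology on closed subsets of $Y$ is generated by the sets $\{A: A\cap K=\emptyset\}$ ($K$ compact) and $\{A: A\cap U\ne\emptyset\}$ ($U$ open). $\mathfrak{M}_\bullet(\tau)$: the set of (representatives of) equivalence classes of triples $(X,\rho_X,a_X)$, with $(X,\rho_X)$ a rooted bcm space and $a_X\in\tau(X)$, where $(X,\rho_X,a_X)\sim(Y,\rho_Y,a_Y)$ iff there is a root-preserving isometry $f\colon X\to Y$ with $\tau_f(a_X)=a_Y$. $\tau$ is space-rooted metrizable if it admits a space-rooted metrization $\tau^{\mathrm{srm}}$: a choice, for each rooted bcm space $(X,\rho_X)$, of a metric $d^{\tau^{\mathrm{srm}}}_{X,\rho_X}$ on $\tau(X)$ inducing the given topology, such that for every root-preserving isometric embedding $f\colon(X,\rho_X)\to(Y,\rho_Y)$ the map $\tau_f$ is distance-preserving. Hausdorff metric on compact subsets (including $\emptyset$) of a metric space $M$: $d^H_M(A,B)=\inf\{\varepsilon\ge0: A\subseteq B^\varepsilon, B\subseteq A^\varepsilon\}$, where $A^\varepsilon=\{x:\exists y\in A, d_M(x,y)\le\varepsilon\}$ and $\inf\emptyset=\infty$. For a rooted bcm space $(M,\rho)$ and closed $A,B\subseteq M$, $$d^F_{M,\rho}(A,B)=\int_0^\infty e^{-r}\bigl(1\wedge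 d^H_M(A\cap D_M(\rho,r),B\cap D_M(\rho,r))\bigr)dr.$$ For embedding-continuous $\tau$, the local GH-type topology with preserved roots on $\mathfrak{M}_\bullet(\tau)$ is the topology induced by the metric $$d_{\mathfrak{M}_\bullet}^{\tau^{\mathrm{srm}}}(\mathcal{X},\mathcal{Y})=\inf_{f,g,Z}\bigl\{d^F_{Z,\rho_Z}(f(X),g(Y))\vee d^{\tau^{\mathrm{srm}}}_{Z,\rho_Z}(\tau_f(a_X),\tau_g(a_Y))\bigr\},$$ $\mathcal{X}=(X,\rho_X,a_X)$, $\mathcal{Y}=(Y,\rho_Y,a_Y)$, the infimum being over all rooted bcm spaces $(Z,\rho_Z)$ and root-preserving isometric embeddings $f\colon X\to Z$, $g\colon Y\to Z$; it does not depend on the choice of $\tau^{\mathrm{srm}}$. *)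

(* Defs.v *)
From HB Require Import structures.
From mathcomp Require Import all_boot all_order all_algebra.
From mathcomp Require Import all_classical all_reals all_analysis.

Set Implicit Arguments.
Unset Strict Implicit.
Unset Printing Implicit Defensive.

Import Order.TTheory GRing.Theory Num.Theory.
Import numFieldNormedType.Exports.

Local Open Scope classical_set_scope.
Local Open Scope ring_scope.

Definition separable_space (T : topologicalType) : Prop :=
  exists2 D : set T, countable D & dense D.

Definition metrizes (R : realType) (T : topologicalType) (d : T -> T -> R) :
    Prop :=
  [/\ forall x y, d x y = 0 <-> x = y,
      forall x y, d x y = d y x,
      forall y x z, d x z <= d x y + d y z
    & forall x (A : set T), nbhs x A <->
        exists2 e : R, 0 < e & [set y | d x y < e] `<=` A].

Definition metrizable (R : realType) (T : topologicalType) : Prop :=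
  exists d : T -> T -> R, metrizes d.

Definition topological_embedding (T U : topologicalType) (f : T -> U) : Prop :=
  [/\ injective f, continuous f
    & forall A, open A -> exists2 B, open B & f @` A = B `&` range f].

(* [metricType] is not used as a record field: its universe lies strictly above
   that of [set], so the types built from it below could not be topological
   spaces. The carrier and distance are bundled instead, and the library
   structure is derived. *)
Record metSpace (R : realType) := MetSpace {
  met_car :> Type;
  met_dist : met_car -> met_car -> R;
  met_distxx : forall x, met_dist x x = 0;
  met_dist_eq0 : forall x y, met_dist x y = 0 -> x = y;
  met_distC : forall x y, met_dist x y = met_dist y x;
  met_distD : forall y x z, met_dist x z <= met_dist x y + met_dist y z
}.

HB.instance Definition _ (R : realType) (X : metSpace R) :=
  gen_eqMixin (met_car X).
HB.instance Definition _ (R : realType) (X : metSpace R) :=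
  gen_choiceMixin (met_car X).
HB.instance Definition _ (R : realType) (X : metSpace R) :=
  isMetric.Build R (met_car X)
    (@met_distxx R X) (@met_dist_eq0 R X) (@met_distC R X) (@met_distD R X).

(* [closed_ball] of the library is the closure of the open ball, which may be
   smaller. *)
Definition disk (R : realType) (X : metricType R) (x : X) (r : R) : set X :=
  [set y | mdist x y <= r].

Record bcmSpace (R : realType) := BcmSpace {
  bcm_met :> metSpace R;
  bcm_nonempty : [set: bcm_met] !=set0;
  bcm_compact : forall (x : bcm_met) (r : R), compact (disk x r)
}.

Record isoEmb (R : realType) (X Y : bcmSpace R) := IsoEmb {
  emb_fun :> X -> Y;
  embP : forall x y, mdist (emb_fun x) (emb_fun y) = mdist x y
}.

Definition emb_id (R : realType) (X : bcmSpace R) : isoEmb X X :=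
  @IsoEmb R X X idfun (fun _ _ => erefl).

Definition emb_comp (R : realType) (X Y Z : bcmSpace R)
    (g : isoEmb Y Z) (f : isoEmb X Y) : isoEmb X Z :=
  @IsoEmb R X Z (g \o f) (fun x y => etrans (embP g (f x) (f y)) (embP f x y)).

Record bcmStructure (R : realType) := BcmStructure {
  str_obj :> bcmSpace R -> topologicalType;
  str_map : forall X Y : bcmSpace R, isoEmb X Y -> str_obj X -> str_obj Y;
  str_metrizable : forall X, metrizable R (str_obj X);
  str_embedding : forall X Y (f : isoEmb X Y),
    topological_embedding (str_map f);
  str_id : forall X a, str_map (emb_id X) a = a;
  str_comp : forall X Y Z (g : isoEmb Y Z) (f : isoEmb X Y) a,
    str_map (emb_comp g f) a = str_map g (str_map f a)
}.

Arguments str_map {R} b {X Y} f _.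

Definition str_separable (R : realType) (tau : bcmStructure R) : Prop :=
  forall X, separable_space (tau X).

Definition str_embedding_continuous (R : realType) (tau : bcmStructure R) : Prop :=
  forall (X Y : bcmSpace R) (f : nat -> isoEmb X Y) (foo : isoEmb X Y),
    {family compact, (fun n => f n : X -> Y) @ \oo --> (foo : X -> Y)} ->
    forall a : tau X,
      str_map tau (f n) a @[n --> \oo] --> str_map tau foo a.

Definition closedSet (Y : topologicalType) := {A : set Y | closed A}.

HB.instance Definition _ (Y : topologicalType) := gen_eqMixin (closedSet Y).
HB.instance Definition _ (Y : topologicalType) := gen_choiceMixin (closedSet Y).

(* The Fell topology. *)
HB.instance Definition _ (Y : topologicalType) :=
  isSubBaseTopological.Build (closedSet Y) (I := set (closedSet Y))
    ([set [set A : closedSet Y | sval A `&` K = set0] | K in @compact Y] `|`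
     [set [set A : closedSet Y | sval A `&` U !=set0] | U in @open Y])
    id.

Lemma isometric_continuous (R : realType) (X Y : metricType R) (f : X -> Y) :
  (forall x y, mdist (f x) (f y) = mdist x y) -> continuous f.
Proof.
move=> fE x; apply/metricType_numDomainType.cvgrPdist_lt => e e0.
near=> y; rewrite fE; near: y.
exact: (metricType_numDomainType.cvgr_dist_lt cvg_id e0).
Unshelve. all: by end_near. Qed.

Lemma closed_range_emb (R : realType) (X Y : bcmSpace R) (f : isoEmb X Y) :
  closed (range f).
Proof.
move=> p clp; have [x0 _] := bcm_nonempty X.
pose K := f @` disk x0 (mdist (f x0) p + 1).
have cf : continuous f by apply: isometric_continuous; exact: embP.
have cK : closed K.
  apply: compact_closed; first exact: metric_hausdorff.
  apply: continuous_compact; last exact: bcm_compact.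
  exact: continuous_subspaceT.
suff : K p by case=> x _ <-; exists x.
apply: cK => B nB.
have [_ [[x _ <-] [Bx]]] : range f `&` (B `&` ball p 1) !=set0.
  by apply: clp; apply: filterI => //; exact: nbhsx_ballx.
rewrite ballEmdist/= => px; exists (f x); split => //; exists x => //.
rewrite /disk/= -(embP f) (le_trans (metric_triangle _ p _))//.
by rewrite lerD2l ltW.
Qed.

Definition range_emb (R : realType) (X Y : bcmSpace R) (f : isoEmb X Y) :
  closedSet Y := exist _ (range f) (@closed_range_emb R X Y f).

Definition str_lower_semicontinuous (R : realType) (tau : bcmStructure R) : Prop :=
  forall (Y : bcmSpace R) (X : nat -> bcmSpace R) (Xoo : bcmSpace R)
      (i : forall n, isoEmb (X n) Y) (ioo : isoEmb Xoo Y),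
    range_emb (i n) @[n --> \oo] --> range_emb ioo ->
    forall a : tau Xoo,
      exists (k : nat -> nat) (b : forall j, tau (X (k j))),
        {homo k : m n / (m < n)%N} /\
        str_map tau (i (k j)) (b j) @[j --> \oo]
          --> str_map tau ioo a.

Record srMetrization (R : realType) (tau : bcmStructure R) := SrMetrization {
  srm_dist :> forall X : bcmSpace R, X -> tau X -> tau X -> R;
  srm_metrizes : forall (X : bcmSpace R) (rho : X), metrizes (srm_dist rho);
  srm_map : forall (X Y : bcmSpace R) (rhoX : X) (rhoY : Y) (f : isoEmb X Y),
    f rhoX = rhoY ->
    forall a b : tau X, srm_dist rhoY (str_map tau f a) (str_map tau f b) =
                        srm_dist rhoX a b
}.

Section hausdorff_fell_distance.
Context (R : realType) (M : metricType R).
Local Open Scope ereal_scope.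

Definition thickening (A : set M) (e : R) : set M :=
  [set x | exists2 y, A y & (mdist x y <= e)%R].

Definition hausdorff_dist (A B : set M) : \bar R :=
  ereal_inf [set e%:E | e in [set e : R |
    [/\ (0 <= e)%R, A `<=` thickening B e & B `<=` thickening A e]]].

Definition fell_dist (rho : M) (A B : set M) : \bar R :=
  \int[@lebesgue_measure R]_(r in `[0%R, +oo[)
    ((expR (- r))%:E *
     mine 1 (hausdorff_dist (A `&` disk rho r) (B `&` disk rho r))).

End hausdorff_fell_distance.

Record markedSpace (R : realType) (tau : bcmStructure R) := MarkedSpace {
  mk_space : bcmSpace R;
  mk_root : mk_space;
  mk_point : tau mk_space
}.

Definition marked_equiv (R : realType) (tau : bcmStructure R)
    (x y : markedSpace tau) : Prop :=
  exists f : isoEmb (mk_space x) (mk_space y),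
    [/\ range f = setT, f (mk_root x) = mk_root y
      & str_map tau f (mk_point x) = mk_point y].

(* [gh_dist] only depends on its arguments up to [marked_equiv]. *)
Definition gh_dist (R : realType) (tau : bcmStructure R)
    (m : srMetrization tau) (x y : markedSpace tau) : \bar R :=
  ereal_inf [set e | exists (Z : bcmSpace R) (rho : Z)
      (f : isoEmb (mk_space x) Z) (g : isoEmb (mk_space y) Z),
    [/\ f (mk_root x) = rho, g (mk_root y) = rho
      & e = maxe (fell_dist rho (range f) (range g))
                 (m Z rho (str_map tau f (mk_point x))
                          (str_map tau g (mk_point y)))%:E]].

Definition markedClass (R : realType) (tau : bcmStructure R) :=
  {C : markedSpace tau -> Prop | exists x, C = marked_equiv x}.

Definition class_repr (R : realType) (tau : bcmStructure R)
    (C : markedClass tau) : markedSpace tau := sval (cid (svalP C)).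

Definition ghSpace (R : realType) (tau : bcmStructure R)
  (m : srMetrization tau) := markedClass tau.

Section gh_topology.
Context (R : realType) (tau : bcmStructure R) (m : srMetrization tau).

Definition gh_open (U : set (ghSpace m)) : Prop :=
  forall C, U C -> exists2 e : R, 0 < e &
    [set C' | (gh_dist m (class_repr C) (class_repr C') < e%:E)%E] `<=` U.

Let gh_openT : gh_open setT.
Proof. by move=> C _; exists 1. Qed.

Let gh_openI : setI_closed gh_open.
Proof.
move=> U V oU oV C [/oU[e e0 eU] /oV[e' e'0 eV]].
exists (Num.min e e'); first by rewrite lt_min e0.
by move=> C' /=; rewrite EFin_min lt_min => /andP[/eU ? /eV].
Qed.

Let gh_open_bigU (I : Type) (f : I -> set (ghSpace m)) :
  (forall i, gh_open (f i)) -> gh_open (\bigcup_i f i).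
Proof.
move=> of_ C [i _ /of_[e e0 ef]].
by exists e => // C' /ef ?; exists i.
Qed.

HB.instance Definition _ := gen_eqMixin (ghSpace m).
HB.instance Definition _ := gen_choiceMixin (ghSpace m).
HB.instance Definition _ :=
  isOpenTopological.Build (ghSpace m) gh_openT gh_openI gh_open_bigU.

End gh_topology.

(* Main.v *)
From HB Require Import structures.
Require Import Defs.
From mathcomp Require Import all_boot all_order all_algebra.
From mathcomp Require Import all_classical all_reals all_analysis.
From mathcomp Require Import measurable_realfun ring lra.

(* An open set contains a [gh_dist]-ball around each of its points, so that two
   approximations can be chained inside it without a triangle inequality for
   [gh_dist]. First, a space [X] is the Fell limit of finite subsets containing
   the root; lower semicontinuity moves a marking of [X] to markings of these
   subsets. Secondly, all metrics on finitely many labelled points embed into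
   one sup-normed space [R^N] by [i |-> (d (i, j) - d (0, j))_j], which sends
   the root to [0]; convergence of the distances becomes convergence of the
   images, and lower semicontinuity applies again. Countably many finite spaces
   [S], each with a countable dense subset of [tau S], therefore suffice. *)

Set Implicit Arguments.
Unset Strict Implicit.
Unset Printing Implicit Defensive.

Import Order.TTheory GRing.Theory Num.Theory.
Import numFieldNormedType.Exports.

Local Open Scope classical_set_scope.
Local Open Scope ring_scope.

(** * The Fell distance and the Fell topology *)

(* The library version assumes both functions measurable, but the Hausdorff
   distance of the truncations need not be shown measurable in the radius. *)
Lemma ge0_le_integral_nonmeasurable d (T : measurableType d) (R : realType)
    (mu : {measure set T -> \bar R}) (D : set T) (f g : T -> \bar R) :
  (forall x, D x -> 0 <= f x)%E -> (forall x, D x -> f x <= g x)%E ->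
  (\int[mu]_(x in D) f x <= \int[mu]_(x in D) g x)%E.
Proof.
move=> f0 fg; rewrite !ge0_integralE//; last first.
  by move=> x Dx; rewrite (le_trans (f0 _ Dx)) ?fg.
(* The integral is a supremum over simple functions below the integrand, and such a function below
   [f] is also below [g]. *)
apply: ereal_sup_le => _ [h hf <-]; exists h => // x.
exact: le_trans (hf x) (lee_restrict fg x).
Qed.

Section fell_distance.
Context (R : realType).
Local Open Scope ereal_scope.

Lemma hausdorff_dist_le (M : metricType R) (A B : set M) (e : R) :
  (0 <= e)%R -> A `<=` thickening B e -> B `<=` thickening A e ->
  hausdorff_dist A B <= e%:E.
Proof. by move=> e0 AB BA; apply: ereal_inf_lbound; exists e. Qed.

Lemma hausdorff_dist_ge0 (M : metricType R) (A B : set M) :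
  0 <= hausdorff_dist A B.
Proof. by apply: le_ereal_inf_tmp => _ [e [e0 _ _] <-]; rewrite lee_fin. Qed.

(* Pointwise, [exp (-r) * min 1 h] is at most
   [(eps + exp (-s/2)) * exp (-r/2)] outside [E], and at most [1] on [E]. *)
Lemma fell_dist_le (M : metricType R) (rho : M) (A B : set M) (E : set R)
    (eps s : R) :
  measurable E -> (0 <= eps)%R ->
  (forall r : R, (0 <= r <= s)%R -> ~ E r ->
    hausdorff_dist (A `&` disk rho r) (B `&` disk rho r) <= eps%:E) ->
  fell_dist rho A B <=
    ((eps + expR (- (s / 2))) * 2)%:E + @lebesgue_measure R E.
Proof.
move=> mE eps0 H.
set c := (_ * 2)%R.
have c0 : (0 <= c)%R by rewrite mulr_ge0// addr_ge0// expR_ge0.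
(* With rate [1/2] the density is [expR (- (r / 2)) / 2] and has integral [1], which accounts for
   the factor [2] in [c]. *)
pose p := exponential_pdf (2^-1 : R).
have p0 x : (0 <= p x)%R by apply: exponential_pdf_ge0.
have mp : measurable_fun setT p by exact: measurable_exponential_pdf.
apply: (@le_trans _ _ (\int[@lebesgue_measure R]_(r in `[0%R, +oo[)
    ((c * p r)%:E + (\1_E r)%:E))).
  apply: ge0_le_integral_nonmeasurable => r; rewrite /= in_itv/= andbT => r0.
    by rewrite mule_ge0 ?lee_fin ?expR_ge0// le_min lee01 hausdorff_dist_ge0.
  have e2 : expR (- r) = (expR (- (r / 2)) * expR (- (r / 2)))%R.
    by rewrite -expRD -opprD -splitr.
  have le1 (x : R) : (0 <= x)%R -> (expR (- (x / 2)) <= 1)%R.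
    by move=> x0; rewrite -expR0 ler_expR oppr_le0 divr_ge0.
  have pE : (c * p r = (eps + expR (- (s / 2))) * expR (- (r / 2)))%R.
    rewrite /p exponential_pdfE// /c mulNr [(2^-1 * r)%R]mulrC.
    by rewrite -mulrA [(2 * _)%R]mulrA divff ?mul1r.
  have [Er|nEr] := pselect (E r).
    rewrite indicE mem_set//.
    apply: (@le_trans _ _ 1); last by rewrite -EFinD lee_fin lerDr mulr_ge0.
    rewrite -[leRHS]mule1; apply: lee_pmul; rewrite ?lee_fin ?expR_ge0//.
    - by rewrite le_min lee01 hausdorff_dist_ge0.
    - by rewrite -expR0 ler_expR oppr_le0.
    - by rewrite ge_min lexx.
  rewrite indicE memNset// adde0 pE.
  have [rs|sr] := leP r s.
    apply: (@le_trans _ _ ((expR (- r))%:E * eps%:E)).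
      by apply: lee_wpmul2l; rewrite ?lee_fin ?expR_ge0// ge_min H ?orbT// r0.
    rewrite -EFinM lee_fin mulrC ler_pM ?expR_ge0//.
      by rewrite lerDl expR_ge0.
    by rewrite e2 ler_piMl ?expR_ge0// le1.
  apply: (@le_trans _ _ ((expR (- r))%:E * 1)).
    by apply: lee_wpmul2l; rewrite ?lee_fin ?expR_ge0// ge_min lexx.
  rewrite mule1 lee_fin e2 ler_wpM2r ?expR_ge0//.
  rewrite (le_trans (y := expR (- (s / 2))))// ?lerDr//.
  by rewrite ler_expR lerN2 ler_pM2r// ltW.
rewrite ge0_integralD//=; last 3 first.
- by move=> x _; rewrite lee_fin mulr_ge0.
- by apply/measurable_EFinP; apply: measurable_funTS; exact: measurable_funM.
- by apply/measurable_EFinP; apply: measurable_funTS; exact: measurable_indic.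
apply: leeD.
  apply: (@le_trans _ _ (\int[@lebesgue_measure R]_r (c * p r)%:E)).
    apply: ge0_subset_integral => //=.
    - apply/measurable_EFinP; exact: measurable_funM.
    - by move=> x _; rewrite lee_fin mulr_ge0.
  under eq_integral do rewrite EFinM.
  rewrite ge0_integralZl//=; last 2 first.
  - exact/measurable_EFinP.
  - by move=> x _; rewrite lee_fin.
  by rewrite integral_exponential_pdf ?invr_gt0// mule1.
rewrite integral_indic//=.
by apply: le_measure; rewrite ?inE//; apply: measurableI.
Qed.

End fell_distance.

(** A Fell neighbourhood contains a finite intersection of subbasic sets, and filters are stable
    under finite intersections, so hit and miss sets can be treated one at a time. *)
Lemma fell_cvg (Y : topologicalType) (A : nat -> closedSet Y)
    (B : closedSet Y) :
  (forall K, compact K -> sval B `&` K = set0 ->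
    \forall n \near \oo, sval (A n) `&` K = set0) ->
  (forall U, open U -> sval B `&` U !=set0 ->
    \forall n \near \oo, sval (A n) `&` U !=set0) ->
  A n @[n --> \oo] --> B.
Proof.
move=> HK HU V [_ [[W sW <-] [C WC CB] sV]].
rewrite nbhs_filterE; apply: filterS sV _; apply: (@filterS _ _ _ C).
  by move=> ? ?; exists C.
have /sW [D sD IDeC] := WC; rewrite -IDeC; apply: filter_bigI => E DE.
have EB : E B by move: CB; rewrite -IDeC => /(_ _ DE).
move: EB; have /sD := DE; rewrite inE => -[[K cK <-]|[U oU <-]].
  exact: HK.
exact: HU.
Qed.

(** * The space of marked classes *)

Lemma metrizes_nbhs_ball (R : realType) (T : topologicalType) (d : T -> T -> R)
    (x : T) (e : R) :
  metrizes d -> 0 < e -> nbhs x [set y | d x y < e].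
Proof. by move=> [_ _ _ dE] e0; apply/dE; exists e. Qed.

Lemma metrizes_open_ball (R : realType) (T : topologicalType) (d : T -> T -> R)
    (x : T) (e : R) :
  metrizes d -> open [set y | d x y < e].
Proof.
move=> [_ _ tri dE]; rewrite openE => y /= xy; apply/dE.
exists (e - d x y); rewrite ?subr_gt0// => z /=; rewrite ltrBrDl.
exact: le_lt_trans.
Qed.

Section gh_space.
Context (R : realType) (tau : bcmStructure R) (m : srMetrization tau).
Implicit Types x y : markedSpace tau.

Definition marked_class x : ghSpace m :=
  exist _ (marked_equiv x) (ex_intro _ x erefl).

Lemma marked_equiv_refl x : marked_equiv x x.
Proof.
exists (emb_id _); split => //; last exact: str_id.
by apply/seteqP; split => // z _; exists z.
Qed.

Lemma class_repr_equiv x (x' := class_repr (marked_class x)) :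
  marked_equiv x x' /\ marked_equiv x' x.
Proof.
have xx' : marked_equiv x = marked_equiv x'.
  by rewrite /x' /class_repr; case: cid => y /= ->.
by split; [rewrite xx'|rewrite -xx']; exact: marked_equiv_refl.
Qed.

Lemma range_emb_comp (X Y Z : bcmSpace R) (g : isoEmb Y Z) (f : isoEmb X Y) :
  range f = setT -> range (emb_comp g f) = range g.
Proof.
move=> fT; apply/seteqP; split => [_ [u _ <-]|_ [v _ <-]].
  by exists (f u).
by have [u _ <-] : range f v by [rewrite fT]; exists u.
Qed.

(** Precomposition with the surjective isometries turns a common embedding of [x] and [y] into one
    of [x'] and [y'] with the same ranges and marks. *)
Lemma gh_dist_equiv x y x' y' :
  marked_equiv x' x -> marked_equiv y' y ->
  (gh_dist m x' y' <= gh_dist m x y)%E.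
Proof.
move=> [h [hT hr ha]] [k [kT kr ka]].
apply: ereal_inf_le_tmp => _ [Z [rho [f [g [fr gr ->]]]]].
exists Z, rho, (emb_comp f h), (emb_comp g k).
by rewrite !range_emb_comp//= !str_comp ha ka hr kr.
Qed.

(** Open sets are defined through chosen representatives; invariance under [marked_equiv] lets them
    be tested on arbitrary marked spaces. *)
Lemma gh_open_class (U : set (ghSpace m)) x :
  open U -> U (marked_class x) ->
  exists2 e : R, 0 < e &
    forall y, (gh_dist m x y < e%:E)%E -> U (marked_class y).
Proof.
move=> oU Ux; have [e e0 eU] := oU _ Ux; exists e => // y xy.
apply: eU => /=; apply: le_lt_trans xy; apply: gh_dist_equiv.
  exact: (class_repr_equiv x).2.
exact: (class_repr_equiv y).2.
Qed.

(** The ambient [Y] itself competes in the infimum defining [gh_dist]. Lower semicontinuity supplies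
    a nearby marking of some [X n], and continuity of [str_map] enlarges it to an open set [V]. *)
Lemma lsc_approx (Y : bcmSpace R) (X : nat -> bcmSpace R) (Xoo : bcmSpace R)
    (i : forall n, isoEmb (X n) Y) (ioo : isoEmb Xoo Y)
    (r : forall n, X n) (roo : Xoo) (a : tau Xoo) (U : set (ghSpace m)) :
  str_lower_semicontinuous tau ->
  (forall n, i n (r n) = ioo roo) ->
  range_emb (i n) @[n --> \oo] --> range_emb ioo ->
  (forall e : R, 0 < e -> \forall n \near \oo,
    (fell_dist (ioo roo) (range ioo) (range (i n)) < e%:E)%E) ->
  open U -> U (marked_class (MarkedSpace roo a)) ->
  exists n (V : set (tau (X n))), [/\ open V, V !=set0 &
    forall b, V b -> U (marked_class (MarkedSpace (r n) b))].
Proof.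
move=> lsc ir cvgX cvgF oU Ua.
have [e e0 eU] := gh_open_class oU Ua.
have [k [b [kinc cvgb]]] := lsc _ _ _ _ _ cvgX a.
have me := srm_metrizes m (ioo roo).
have nb := metrizes_nbhs_ball (str_map tau ioo a) me e0.
(* A strictly increasing [k] dominates the identity, so what holds eventually in [n] also holds
   eventually along [k n]. *)
have kn n : (n <= k n)%N.
  by elim: n => // n IH; rewrite (leq_ltn_trans IH)// kinc.
have [n1 _ Hn1] := cvgb _ nb.
have [n2 _ Hn2] := cvgF _ e0.
pose j := maxn n1 n2; exists (k j).
exists ((str_map tau (i (k j))) @^-1`
  [set y | m _ (ioo roo) (str_map tau ioo a) y < e]); split.
- apply: open_comp; last exact: metrizes_open_ball.
  by have [_ c _] := str_embedding tau (i (k j)) => ? _; exact: c.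
- by exists (b j); apply: Hn1; rewrite /= leq_maxl.
- move=> c /= Vc; apply: eU => /=; apply: (@le_lt_trans _ _
    (maxe (fell_dist (ioo roo) (range ioo) (range (i (k j))))
      (m Y (ioo roo) (str_map tau ioo a) (str_map tau (i (k j)) c))%:E)).
    apply: ereal_inf_lbound; exists Y, (ioo roo), ioo, (i (k j)); split => //.
    exact: ir.
  by rewrite gt_max lte_fin Vc Hn2//= (leq_trans (leq_maxr n1 n2))//= -/j.
Qed.

End gh_space.

(** * Finite spaces *)

Lemma continuous_mdist (R : realType) (X : metricType R) (rho : X) :
  continuous (mdist rho : X -> R).
Proof.
move=> u; apply/cvgrPdist_lt => d d0; near=> v.
have uv : mdist u v < d.
  by near: v; exact: (metricType_numDomainType.cvgr_dist_lt cvg_id d0).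
rewrite ltr_norml; have := metric_triangle rho u v.
have := metric_triangle rho v u; rewrite (metric_sym v u).
by move=> *; apply/andP; split; lra.
Unshelve. all: by end_near. Qed.

(** * Radial finite nets in a bcm space *)

Section finite_net.
Context (R : realType) (X : bcmSpace R).

Lemma disk_nearest (rho x : X) (e : R) : 0 <= e ->
  exists2 y : X, mdist x y <= e &
    forall z, mdist x z <= e -> mdist rho y <= mdist rho z.
Proof.
move=> e0; have [||| y /set_mem xy ymin] :=
  @compact_EVT_min X R (mdist rho) (disk x e).
- by exists x; rewrite /disk/= mdistxx.
- exact: bcm_compact.
- by apply: continuous_subspaceT; exact: continuous_mdist.
- by exists y => // z xz; apply: ymin; exact: mem_set.
Qed.

Lemma bcm_finite_cover (rho : X) (s e : R) : 0 < e ->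
  exists t : seq X, forall z, mdist rho z <= s ->
    exists2 x, x \in t & mdist x z < e.
Proof.
move=> e0.
(* The root is the base point of a pointed copy of [X], on which compactness becomes the finite
   cover property. *)
pose Xp : ptopologicalType := HB.pack_for ptopologicalType (met_car X)
  (isPointed.Build (met_car X) rho).
have := @bcm_compact R X rho s.
rewrite -[compact _]/(@compact Xp (disk rho s)) compact_cover.
move=> /(_ _ setT (fun x => (ball (x : X) e)^°)) [].
- by move=> x _; exact: open_interior.
- move=> z _; exists z => //.
  exact: nbhsx_ballx.
- move=> D _ cD; exists (finmap.enum_fset D) => z /cD[x xD /interior_subset].
  by rewrite ballEmdist => xz; exists x.
Qed.

(* Each point of a covering ball is replaced by a point of it that is closest
   to the root, so that truncating the net at any radius [r <= s] still leaves
   an [e]-net of the disk of radius [r]. *)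
Lemma radial_net (rho : X) (s e : R) : 0 < e ->
  exists N (p : 'I_N.+1 -> X), p ord0 = rho /\
    forall z, mdist rho z <= s ->
      exists2 i, mdist z (p i) <= e & mdist rho (p i) <= mdist rho z.
Proof.
move=> e0; have e20 : 0 < e / 2 by rewrite divr_gt0.
have [t tP] := bcm_finite_cover rho s e20.
have /choice[y yP] : forall x : X, exists y, mdist x y <= e / 2 /\
    forall z, mdist x z <= e / 2 -> mdist rho y <= mdist rho z.
  by move=> x; have [y] := disk_nearest rho x (ltW e20); exists y.
(* The root is put in front to receive label [ord0], which shifts the labels of the net by one; the
   default of [nth] is never reached. *)
exists (size t), (fun i => nth rho (rho :: map y t) i).
split => // z /tP[x xt xz].
have lt : (index x t < size t)%N by rewrite index_mem.
exists (lift ord0 (Ordinal lt)); rewrite lift0/= (nth_map rho)// nth_index//.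
  have [xy _] := yP x.
  by have := metric_triangle z x (y x); rewrite (metric_sym z x); lra.
by have [_ ] := yP x; apply; exact: ltW.
Qed.

End finite_net.

(* A finite space is handled through a labelling of its points, possibly with
   repetitions; the root has label [ord0]. *)
Record labelled (R : realType) (N : nat) := Labelled {
  lab_space :> bcmSpace R;
  lab : 'I_N.+1 -> lab_space;
  lab_surj : range lab = setT
}.

Section image_space.
Context (R : realType) (X : bcmSpace R) (N : nat) (p : 'I_N.+1 -> X).

Lemma sval_dist_eq0 (x y : {x : X | range p x}) :
  mdist (sval x) (sval y) = 0 -> x = y.
Proof.
by move/mdist_positivity; apply: eq_sig_hprop => ? ? ?; exact: Prop_irrelevance.
Qed.

(** The carrier is the image rather than the label set, because labels may repeat and distance [0]
    must force equality. *)
Definition image_met : metSpace R :=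
  @MetSpace R {x : X | range p x} (fun x y => mdist (sval x) (sval y))
    (fun x => mdistxx (sval x)) sval_dist_eq0
    (fun x y => metric_sym (sval x) (sval y))
    (fun y x z => metric_triangle (sval x) (sval y) (sval z)).

Definition image_lab (i : 'I_N.+1) : image_met :=
  exist (range p) (p i) (ex_intro2 _ _ i I erefl).

Lemma range_image_lab : range image_lab = setT.
Proof.
apply/seteqP; split => // x _; have [i _ px] := svalP x; exists i => //.
by apply: eq_sig_hprop => // ? ? ?; exact: Prop_irrelevance.
Qed.

Lemma image_compact (x : image_met) (r : R) : compact (disk x r).
Proof.
apply: finite_compact; apply: (@sub_finite_set _ _ (range image_lab)).
  by rewrite range_image_lab.
exact: finite_image.
Qed.

Definition image_bcm : bcmSpace R :=
  @BcmSpace R image_met (ex_intro _ (image_lab ord0) I) image_compact.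

Definition image_labelled : labelled R N :=
  @Labelled R N image_bcm image_lab range_image_lab.

Definition image_emb : isoEmb image_labelled X :=
  @IsoEmb R image_labelled X (fun x => sval x) (fun _ _ => erefl).

End image_space.

Lemma range_lab_emb (R : realType) (N : nat) (L : labelled R N)
    (Y : bcmSpace R) (f : isoEmb L Y) :
  range f = range (f \o lab L).
Proof.
apply/seteqP; split => [_ [x _ <-]|_ [i _ <-]]; last by exists (lab L i).
by have [i _ <-] : range (lab L) x by [rewrite lab_surj]; exists i.
Qed.

(* The type ['rV[R]_n.+1] lives in too large a universe to be the carrier of a
   [metSpace], hence its encoding as the sequences vanishing from [n.+1] on. *)
Section sup_norm_space.
Context (R : realType) (n : nat).

Definition row_car := {f : nat -> R | forall k, (n < k)%N -> f k = 0}.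

Definition row_of_car (f : row_car) : 'rV[R]_n.+1 := \row_k sval f k.

Definition car_of_row (v : 'rV[R]_n.+1) : row_car :=
  exist (fun f : nat -> R => forall k, (n < k)%N -> f k = 0)
    (fun k => if (k <= n)%N then v ord0 (inord k) else 0)
    (fun k nk => ifN _ _ (negbT (ltn_geF nk))).

Lemma car_of_rowK : cancel car_of_row row_of_car.
Proof.
move=> v; apply/rowP => k; rewrite mxE /= -ltnS ltn_ord; congr (v _ _).
by apply: val_inj; rewrite /= inordK.
Qed.

Lemma row_of_carK : cancel row_of_car car_of_row.
Proof.
move=> f; apply: eq_sig_hprop => [? ? ?|]; first exact: Prop_irrelevance.
apply/funext => k /=; case: leqP => [kn|nk]; first by rewrite mxE inordK.
by rewrite (svalP f).
Qed.

Lemma row_dist_eq0 (f g : row_car) :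
  `|row_of_car f - row_of_car g| = 0 -> f = g.
Proof. by move/normr0_eq0/subr0_eq/(can_inj row_of_carK). Qed.

Definition row_met : metSpace R :=
  @MetSpace R row_car (fun f g => `|row_of_car f - row_of_car g|)
    (fun f => etrans (congr1 _ (subrr _)) (normr0 _))
    row_dist_eq0
    (fun f g => distrC _ _)
    (fun g f h => ler_distD _ _ _).

(** Heine-Borel in ['rV[R]_n.+1], transported by the continuous map [car_of_row]. *)
Lemma row_met_compact (f : row_met) (r : R) : compact (disk f r).
Proof.
pose x := row_of_car f.
have -> : disk f r = (car_of_row : _ -> row_met) @` [set y | `|x - y| <= r].
  apply/seteqP; split => [g fg|_ [y xy <-]].
    by exists (row_of_car g); rewrite ?row_of_carK.
  by rewrite -(car_of_rowK y) in xy.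
apply: continuous_compact.
  apply: continuous_subspaceT => u.
  apply/(@metricType_numDomainType.cvgrPdist_lt _ row_met _ (nbhs u)) => e e0.
  have : nbhs u (ball u e) by exact: nbhsx_ballx.
  rewrite -ball_normE; apply: (@filterS _ (nbhs u)) => v /= uv.
  rewrite -[mdist _ _]/(`|row_of_car (car_of_row u) -
                          row_of_car (car_of_row v)|).
  by rewrite !car_of_rowK.
apply: bounded_closed_compact.
  exists (`|x| + r); split; first exact: num_real.
  move=> M xM y /= xy.
  apply: le_trans (ltW xM); have := ler_normB x (x - y).
  by rewrite subKr => /le_trans; apply; rewrite lerD2l.
exact: closed_closed_ball_.
Qed.

Definition row_bcm : bcmSpace R :=
  @BcmSpace R row_met (ex_intro _ (car_of_row 0) I) row_met_compact.

(** * The Kuratowski embedding of a labelled space *)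

Section kuratowski.
Context (L : labelled R n).

Definition kuratowski_row (s : L) : 'rV[R]_n.+1 :=
  \row_j (mdist s (lab L j) - mdist (lab L ord0) (lab L j)).

(** The root terms cancel in the difference. The triangle inequality bounds each coordinate, and the
    coordinate of a label of [t] attains the bound. *)
Lemma norm_kuratowski_row (s t : L) :
  `|kuratowski_row s - kuratowski_row t| = mdist s t.
Proof.
have E (j : 'I_n.+1) : (kuratowski_row s - kuratowski_row t) ord0 j =
    mdist s (lab L j) - mdist t (lab L j) by rewrite !mxE; ring.
rewrite [LHS]/Num.Def.normr/= mx_normrE.
apply/eqP; rewrite eq_le; apply/andP; split.
  apply: bigmax_le => [|[i j] _ /=]; first exact: mdist_ge0.
  rewrite (ord1 i) E ler_norml.
  have := metric_triangle s t (lab L j).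
  have := metric_triangle t s (lab L j); rewrite (metric_sym t s).
  by move=> *; apply/andP; split; lra.
have [j _ jt] : range (lab L) t by rewrite lab_surj.
apply: le_trans (le_bigmax _ _ (ord0, j)); rewrite /= E jt mdistxx subr0.
exact: ler_norm.
Qed.

Lemma kuratowskiP (s t : L) :
  mdist (car_of_row (kuratowski_row s) : row_bcm)
    (car_of_row (kuratowski_row t) : row_bcm) = mdist s t.
Proof. by rewrite -norm_kuratowski_row -[LHS]/(`|_ - _|) !car_of_rowK. Qed.

Definition kuratowski : isoEmb L row_bcm :=
  @IsoEmb R L row_bcm (fun s => car_of_row (kuratowski_row s)) kuratowskiP.

(** The image does not depend on [L], so all spaces with [n.+1] labels share one root in
    [row_bcm]. *)
Lemma kuratowski_root : kuratowski (lab L ord0) = car_of_row 0.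
Proof. by congr car_of_row; apply/rowP => j; rewrite !mxE subrr. Qed.

End kuratowski.

(** Each coordinate is a difference of two distances, and each of these changes by at most [e]. *)
Lemma kuratowski_close (L L' : labelled R n) (e : R) :
  (forall i j,
    `|mdist (lab L i) (lab L j) - mdist (lab L' i) (lab L' j)| <= e) ->
  forall i, mdist (kuratowski L (lab L i)) (kuratowski L' (lab L' i)) <= 2 * e.
Proof.
move=> H i; rewrite -[mdist _ _]/(`|_ - _|) !car_of_rowK.
have e0 : 0 <= e by apply: le_trans (H ord0 ord0); rewrite normr_ge0.
rewrite [leLHS]/Num.Def.normr/= mx_normrE; apply: bigmax_le => [|[k j] _ /=].
  by rewrite mulr_ge0.
rewrite !mxE; have := H i j; have := H ord0 j; rewrite !ler_norml.
by move=> /andP[? ?] /andP[? ?]; apply/andP; split; lra.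
Qed.

End sup_norm_space.

Lemma open_mdist (R : realType) (X : metricType R) (U : set X) (x : X) :
  open U -> U x -> exists2 e : R, 0 < e & forall y, mdist x y < e -> U y.
Proof.
move=> oU Ux; have : nbhs x U by exact: open_nbhs_nbhs.
move=> /nbhs_ballP[e /= e0 eU]; exists e => // y xy; apply: eU.
by rewrite ballEmdist.
Qed.

Lemma lt_expR_half (R : realType) (e : R) : 0 < e ->
  exists2 s : R, 0 <= s & expR (- (s / 2)) < e.
Proof.
(* With [s = 2 / e] the claim becomes [e^-1 < expR e^-1], a consequence of [1 + x <= expR x]. *)
move=> e0; exists (2 / e); first by rewrite divr_ge0// ltW.
rewrite expRN -[ltRHS]invrK ltf_pV2 ?posrE ?expR_gt0 ?invr_gt0//.
have -> : 2 / e / 2 = e^-1 by field; rewrite gt_eqF.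
by apply: lt_le_trans (expR_ge1Dx _); rewrite ltrDr.
Qed.

(** * Fell convergence of finite sets from convergence of their labelled points *)

Section finite_convergence.
Context (R : realType) (Y : bcmSpace R) (N : nat).
Variables (q : nat -> 'I_N.+1 -> Y) (qoo : 'I_N.+1 -> Y).
Hypothesis cvgq : forall e : R, 0 < e ->
  \forall k \near \oo, forall i, mdist (qoo i) (q k i) <= e.

Lemma finite_open_near (U : set Y) (i : 'I_N.+1) : open U -> U (qoo i) ->
  \forall k \near \oo, U (q k i).
Proof.
move=> oU Ui; have [e e0 eU] := open_mdist oU Ui.
have e20 : 0 < e / 2 by rewrite divr_gt0.
near=> k; apply: eU; apply: (@le_lt_trans _ _ (e / 2)).
  by move: (i); near: k; exact: cvgq.
by rewrite ltr_pdivrMr// ltr_pMr// ltr1n.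
Unshelve. all: by end_near. Qed.

(** Both conditions of [fell_cvg] reduce to open sets: the complement of a compact set is open, and
    only finitely many labels must enter it. *)
Lemma finite_fell_cvg (A : nat -> closedSet Y) (B : closedSet Y) :
  (forall k, sval (A k) = range (q k)) -> sval B = range qoo ->
  A k @[k --> \oo] --> B.
Proof.
move=> AE BE; apply: fell_cvg => [K cK|U oU].
- rewrite BE => BK.
  have oK : open (~` K).
    apply: closed_openC; apply: compact_closed => //; exact: metric_hausdorff.
  have : \forall k \near \oo, forall i, (~` K) (q k i).
    apply: filter_forall => i; apply: finite_open_near => // Ki.
    by have : (range qoo `&` K) (qoo i) by []; rewrite BK.
  apply: filterS => k qK; rewrite AE -subset0 => _ [[i _ <-]].
  exact: qK.
- rewrite BE => -[_ [[i _ <-] Ui]].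
  have := finite_open_near oU Ui; apply: filterS => k Uk.
  by exists (q k i); rewrite AE; split.
Qed.

(* The truncations at radius [r] match unless [r] is within [d] of the distance
   of some point of the limit to the root. *)
Lemma finite_fell_dist (rho : Y) (e : R) : 0 < e ->
  \forall k \near \oo, (fell_dist rho (range qoo) (range (q k)) < e%:E)%E.
Proof.
move=> e0; have e40 : 0 < e / 4 by rewrite divr_gt0.
have [s s0 hs] := lt_expR_half e40.
(* The final bound is [2 * (N + 2) * d + 2 * expR (- (s / 2))]; this [d] makes the first term
   [e / 2], and the second is smaller than [e / 2]. *)
pose d := e / (4 * (N + 2)%:R).
have d0 : 0 < d by rewrite divr_gt0// mulr_gt0// ltr0n addnS.
have := cvgq d0; apply: filterS => k kd.
pose I j := `[mdist rho (qoo (inord j)) - d,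
  mdist rho (qoo (inord j)) + d]%classic.
pose E := \big[setU/set0]_(i < N.+1) I i.
have mI i : measurable (I i : set R) by exact: measurable_itv.
have mE : measurable (E : set R) by exact: bigsetU_measurable.
have muE : (@lebesgue_measure R E <= (N.+1%:R * (2 * d))%:E)%E.
  apply: (@le_trans _ _ (\sum_(i < N.+1) @lebesgue_measure R (I i))%E).
    apply: (@Boole_inequality _ _ _ (@lebesgue_measure R) I N.+1) => j _.
    exact: mI.
  rewrite (eq_bigr (fun=> (2 * d)%:E)).
    by rewrite sumEFin sumr_const card_ord -[(_ *+ N.+1)%R]mulr_natl.
  move=> i _; rewrite /I lebesgue_measure_itv/= lte_fin ifT; last lra.
  by rewrite -EFinB; congr EFin; ring.
have close i r : ~ E r -> (mdist rho (qoo i) <= r) = (mdist rho (q k i) <= r).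
  move=> nE; have : ~ I i r.
    by move=> Ir; apply: nE; rewrite /E -bigcup_mkord; exists i => /=.
  rewrite /I inord_val /= in_itv/= => /negP; rewrite negb_and -!ltNge.
  have := kd i; have := metric_triangle rho (qoo i) (q k i).
  have := metric_triangle rho (q k i) (qoo i).
  rewrite (metric_sym (q k i)) => H1 H2 H3 /orP[] H4.
    by apply/idP/idP; lra.
  by apply/idP/idP; lra.
apply: (@le_lt_trans _ _
  (((d + expR (- (s / 2))) * 2)%:E + (N.+1%:R * (2 * d))%:E)%E).
  apply: le_trans (leeD2l _ muE).
  apply: fell_dist_le => // [|r _ nE]; first exact: ltW.
  apply: hausdorff_dist_le; first exact: ltW.
    move=> _ [[i _ <-] ir]; exists (q k i) => //.
    by split; [exists i|rewrite /disk/= -close].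
  move=> _ [[i _ <-] ir]; exists (qoo i); last by rewrite metric_sym.
  by split; [exists i|rewrite /disk/= close].
rewrite -EFinD lte_fin.
have dE : d * (4 * (N + 2)%:R) = e.
  by rewrite /d divfK// mulf_neq0// pnatr_eq0 addnS.
rewrite natrD in dE; rewrite -natr1; nra.
Qed.

End finite_convergence.

(** * Separability *)

Section separability.
Context (R : realType) (tau : bcmStructure R) (m : srMetrization tau).

Lemma marked_class_surj (C : ghSpace m) : exists x, C = marked_class m x.
Proof.
have [x Cx] := svalP C; exists x.
by apply: eq_sig_hprop => // ? ? ?; exact: Prop_irrelevance.
Qed.

Lemma range_image_emb (X : bcmSpace R) (N : nat) (p : 'I_N.+1 -> X) :
  range (image_emb p) = range p.
Proof. by rewrite range_lab_emb. Qed.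

(** The [n]-th net has precision [1 / n.+1] on the disk of radius [n]. Being radial, it is also a
    net of every smaller disk, which bounds all truncated Hausdorff distances. *)
Lemma radial_net_cvg (X : bcmSpace R) (rho : X) :
  exists (N : nat -> nat) (p : forall n, 'I_(N n).+1 -> X),
  [/\ forall n, p n ord0 = rho,
      range_emb (image_emb (p n)) @[n --> \oo] --> range_emb (emb_id X)
    & forall e : R, 0 < e -> \forall n \near \oo,
        (fell_dist rho (range (emb_id X)) (range (image_emb (p n))) < e%:E)%E].
Proof.
have inv0 n : 0 < n.+1%:R^-1 :> R by rewrite invr_gt0.
have /choice[Np NpP] : forall n, exists Np : {N & 'I_N.+1 -> X},
    projT2 Np ord0 = rho /\ forall z, mdist rho z <= n%:R ->
      exists2 i, mdist z (projT2 Np i) <= n.+1%:R^-1 &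
        mdist rho (projT2 Np i) <= mdist rho z.
  move=> n; have [N [p pP]] := radial_net rho n%:R (inv0 n).
  by exists (existT _ N p).
exists (fun n => projT1 (Np n)), (fun n => projT2 (Np n)); split.
- by move=> n; have [] := NpP n.
- apply: fell_cvg => [K _ /= K0|U oU /= [_ [[x _ <-] Ux]]].
    apply: nearW => n; rewrite -subset0 => x [_ Kx].
    by rewrite -K0; split => //; exists x.
  have [e e0 eU] := open_mdist oU Ux; near=> n.
  have xn : mdist rho x <= n%:R by near: n; exact: nbhs_infty_ger.
  have [_ /(_ _ xn)[i xi _]] := NpP n.
  exists (projT2 (Np n) i); split; first by rewrite range_image_emb; exists i.
  apply: eU; apply: le_lt_trans xi _; near: n.
  exact: near_infty_natSinv_lt (PosNum e0).
- move=> e e0; have e40 : 0 < e / 4 by rewrite divr_gt0.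
  have [s s0 hs] := lt_expR_half e40; near=> n.
  have sn : s <= n%:R by near: n; exact: nbhs_infty_ger.
  have ne : n.+1%:R^-1 < e / 4.
    by near: n; exact: (near_infty_natSinv_lt (PosNum e40)).
  apply: (@le_lt_trans _ _ (((n.+1%:R^-1 + expR (- (s / 2))) * 2)%:E + 0)%E).
    (* The set of exceptional radii is empty here. *)
    rewrite -(@measure0 _ _ _ (@lebesgue_measure R)).
    apply: fell_dist_le => // r /andP[r0 rs] _.
    apply: hausdorff_dist_le; first exact: ltW.
      move=> z [_ zr]; have zn : mdist rho z <= n%:R.
        by rewrite (le_trans zr)// (le_trans rs).
      have [_ /(_ _ zn)[i zi ri]] := NpP n.
      exists (projT2 (Np n) i) => //; split; last exact: le_trans ri zr.
      by rewrite range_image_emb; exists i.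
    move=> z [_ zr]; exists z; last by rewrite mdistxx ltW.
    by split => //; exists z.
  rewrite adde0 lte_fin [ltRHS](_ : e = (e / 4 + e / 4) * 2); last by field.
  by rewrite ltr_pM2r// ltrD.
Unshelve. all: by end_near. Qed.

Lemma open_meets_finite (U : set (ghSpace m)) :
  str_lower_semicontinuous tau -> open U -> U !=set0 ->
  exists N (L : labelled R N) (b : tau L),
    U (marked_class m (MarkedSpace (lab L ord0) b)).
Proof.
move=> lsc oU [C UC]; have [[X rho a] Cx] := marked_class_surj C.
rewrite {}Cx in UC.
have [N [p [p0 cvgp fellp]]] := radial_net_cvg rho.
have [n [V [_ [b Vb] VU]]] := @lsc_approx R tau m X
  (fun n => image_labelled (p n)) X (fun n => image_emb (p n)) (emb_id X)
  (fun n => lab (image_labelled (p n)) ord0) rho a U lsc p0 cvgp fellp oU UC.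
by exists (N n), (image_labelled (p n)), b; exact: VU.
Qed.

(** The code [ck] ranges over a countable type; its matrix need not be a metric. *)
Definition rat_close (N : nat) (ck : 'M[rat]_N.+1 * nat) (L : labelled R N) :=
  forall i j, `|mdist (lab L i) (lab L j) - ratr (ck.1 i j)| <= ck.2.+1%:R^-1.

Lemma rat_close_ex (N : nat) (L : labelled R N) (k : nat) :
  exists c, rat_close (c, k) L.
Proof.
have k0 : 0 < k.+1%:R^-1 :> R by rewrite invr_gt0.
have /choice[f fP] : forall ij : 'I_N.+1 * 'I_N.+1, exists q : rat,
    `|mdist (lab L ij.1) (lab L ij.2) - ratr q| <= k.+1%:R^-1.
  move: (k.+1%:R^-1) k0 => e e0 [i j] /=; set d := mdist _ _.
  have [|q] := @rat_in_itvoo R d (d + e); first by rewrite ltrDl.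
  rewrite in_itv/= => /andP[H1 H2]; exists q; rewrite ler_norml.
  by apply/andP; split; lra.
by exists (\matrix_(i, j) f (i, j)) => i j /=; rewrite mxE; exact: fP (i, j).
Qed.

(* The selected spaces come within [2 / k.+1] of every labelled space, because
   a selection is made for every rational matrix that some space realizes. *)
Lemma countable_labelled (N : nat) :
  exists sel : 'M[rat]_N.+1 * nat -> option (labelled R N),
  forall (L : labelled R N) k, exists c, exists2 S, sel (c, k) = Some S &
    forall i j, `|mdist (lab L i) (lab L j) - mdist (lab S i) (lab S j)| <=
      2 * k.+1%:R^-1.
Proof.
have /choice[sel selP] : forall ck : 'M[rat]_N.+1 * nat,
    exists o, (exists L, rat_close ck L) ->
      exists2 S, o = Some S & rat_close ck S.
  move=> ck; have [[L HL]|nL] := pselect (exists L, rat_close ck L).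
    by exists (Some L) => _; exists L.
  by exists None => /nL.
exists sel => L k; have [c cL] := rat_close_ex L k.
have [S SE cS] := selP (c, k) (ex_intro _ L cL).
exists c, S => // i j; have := cL i j; have := cS i j => /=.
move: (k.+1%:R^-1) => e; rewrite !ler_norml => /andP[? ?] /andP[? ?].
by apply/andP; split; lra.
Qed.

Lemma open_meets_approx (U : set (ghSpace m)) (N : nat) (L : labelled R N)
    (S : nat -> labelled R N) (b : tau L) :
  str_lower_semicontinuous tau ->
  (forall k i j,
    `|mdist (lab L i) (lab L j) - mdist (lab (S k) i) (lab (S k) j)| <=
      2 * k.+1%:R^-1) ->
  open U -> U (marked_class m (MarkedSpace (lab L ord0) b)) ->
  exists k (V : set (tau (S k))), [/\ open V, V !=set0 &
    forall c, V c -> U (marked_class m (MarkedSpace (lab (S k) ord0) c))].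
Proof.
move=> lsc SL oU UL.
have cvgq (e : R) : 0 < e -> \forall k \near \oo, forall i,
    mdist ((kuratowski L \o lab L) i) ((kuratowski (S k) \o lab (S k)) i) <= e.
  (* The embedding doubles the error [2 / k.+1], hence the threshold [e / 4]. *)
  move=> e0; have e40 : 0 < e / 4 by rewrite divr_gt0.
  near=> k => i; apply: le_trans (kuratowski_close (SL k) i) _.
  have : k.+1%:R^-1 < e / 4.
    by near: k; exact: (near_infty_natSinv_lt (PosNum e40)).
  by move: (k.+1%:R^-1) => u; lra.
apply: (@lsc_approx R tau m (row_bcm R N) (fun k => S k) L
  (fun k => kuratowski (S k)) (kuratowski L) (fun k => lab (S k) ord0)
  (lab L ord0) b U) => //.
- by move=> k; rewrite !kuratowski_root.
- by apply: (finite_fell_cvg cvgq) => [k|]; exact: range_lab_emb.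
- move=> e e0; have := finite_fell_dist cvgq (kuratowski L (lab L ord0)) e0.
  by apply: filterS => k; rewrite !range_lab_emb.
Unshelve. all: by end_near. Qed.

End separability.

Theorem theorem6p41 (R : realType) (tau : bcmStructure R) :
  str_separable tau ->
  str_embedding_continuous tau ->
  str_lower_semicontinuous tau ->
  forall m : srMetrization tau, separable_space (ghSpace m).
Proof.
move=> sep _ lsc m.
pose D (X : bcmSpace R) := sval (cid2 (sep X)).
have DP X : countable (D X) /\ dense (D X) by rewrite /D; case: cid2.
(* Codes that [sel N] sends to [None] contribute the empty set to the countable union. *)
pose sel N := sval (cid (@countable_labelled R N)).
have selP N := svalP (cid (@countable_labelled R N)).
pose D1 N ck : set (ghSpace m) := if sel N ck is Some F then
  [set marked_class m (MarkedSpace (lab F ord0) b) | b in D F] else set0.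
exists (\bigcup_N \bigcup_ck D1 N ck).
  apply: bigcup_countable => // N _; apply: bigcup_countable => // ck _.
  rewrite /D1; case: (sel N ck) => [F|]; last exact: countable0.
  by apply: sub_countable (card_image_le _ _) _; have [] := DP F.
move=> U U0 oU; have [N [L [b Ub]]] := open_meets_finite lsc oU U0.
have /choice[c /choice[S SP]] : forall k, exists c, exists S,
    sel N (c, k) = Some S /\
    forall i j, `|mdist (lab L i) (lab L j) - mdist (lab S i) (lab S j)| <=
      2 * k.+1%:R^-1.
  by move=> k; have [c [S ? ?]] := selP N L k; exists c, S.
have [k [V [oV V0 VU]]] := open_meets_approx lsc (fun k => (SP k).2) oU Ub.
(* [V] is open and nonempty in [tau (S k)], so it meets the chosen dense set there. *)
have [_ /(_ _ V0 oV)[a [Va Da]]] := DP (S k).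
exists (marked_class m (MarkedSpace (lab (S k) ord0) a)).
split; first exact: VU.
exists N => //; exists (c k, k) => //; rewrite /D1.
by have [-> _] := SP k; exists a.
Qed.
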